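(* Let $\mu$ be a probability measure on a set $X$. Let $F$ be $C^2$ on $(0,+\infty)$ with $F(1)=0$, concave, non-decreasing, going to infinity at $+\infty$, and such that $uF'(u)$ is bounded by a constant $K(F)$ on $(0,+\infty)$. If $\mu$ satisfies a defective $F$-Sobolev inequality and a Poincaré inequality, i.e. for all smooth enough $f$ $$\int f^2F\left(\frac{f^2}{\mu(f^2)}\right)d\mu\le C_F\int|\nabla f|^2d\mu+\widetilde C_F\int f^2d\mu$$ and $$\int\left(f-\int f\,d\mu\right)^2d\mu\le C_P\int|\nabla f|^2d\mu,$$ then $\mu$ satisfies a tight $F$-Sobolev inequality, more precisely $$\int f^2F\left(\frac{f^2}{\mu(f^2)}\right)d\mu\le C_F'\int|\nabla f|^2d\mu,\qquad C_F'=C_F+C_P\left(\widetilde C_F+C_{Rot}(F)\right).$$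
   Context: $|\nabla f|^2$ stands for the carré du champ $\Gamma(f,f)$ of a $\mu$-symmetric diffusion semigroup on $X$ (e.g. the usual squared gradient on $\mathbb R^n$), and $\mu(g)=\int g\,d\mu$. $C_{Rot}(F)$ is a constant depending only on $F$ (it exists whenever $F$ is $C^2$ on $(0,+\infty)$ with $F(1)=0$, concave, non-decreasing, going to infinity at $+\infty$, and such that $uF'(u)$ is bounded by a constant $K(F)$ on $(0,+\infty)$) such that for every probability measure $\mu$ and every bounded function $f$, with $\tilde f=f-\int f\,d\mu$, $$\int f^2F\left(\frac{f^2}{\mu(f^2)}\right)d\mu\le\int\tilde f^2F\left(\frac{\tilde f^2}{\mu(\tilde f^2)}\right)d\mu+C_{Rot}(F)\int\tilde f^2d\mu .$$ The integrands $g^2F(g^2/\mu(g^2))$ are taken to be $0$ where $g=0$. *)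

(* Defs.v *)
From HB Require Import structures.
From mathcomp Require Import all_boot all_order all_algebra.
From mathcomp Require Import all_classical all_reals all_analysis.

Set Implicit Arguments.
Unset Strict Implicit.
Unset Printing Implicit Defensive.

Import Order.TTheory GRing.Theory Num.Theory.
Import numFieldNormedType.Exports.

Local Open Scope classical_set_scope.
Local Open Scope ring_scope.

Definition smooth (R : realType) (phi : R -> R) : Prop :=
  forall (n : nat) (x : R), derivable (derive1n n phi) x 1.

(* F is a total function R -> R, but only its values on ]0, +oo[ are
   constrained. *)
Record admissible (R : realType) (F : R -> R) : Prop := {
  adm_derivable : forall u : R, 0 < u -> derivable F u 1 ;
  adm_derivable2 : forall u : R, 0 < u -> derivable (derive1 F) u 1 ;
  adm_C2 : forall u : R, 0 < u -> {for u, continuous (derive1n 2 F)} ;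
  adm_one : F 1 = 0 ;
  adm_concave : convex_function (`]0, +oo[ : set R) (\- F) ;
  adm_nondecreasing : {in `]0, +oo[ &, {homo F : u v / u <= v}} ;
  adm_cvg : F u @[u --> +oo] --> +oo ;
  adm_bound : exists K : R, forall u : R, 0 < u -> u * derive1 F u <= K
}.

Section semigroup.
Context (d : measure_display) (X : measurableType d) (R : realType).
Variable mu : probability X R.

Definition L2_norm (f : X -> R) : \bar R := 'N[mu]_2%:E[EFin \o f]%E.

(* Square-integrable functions are represented by genuine functions X -> R, so
   the identities below hold mu-almost everywhere. The value of P at negative
   times or at functions that are not square-integrable is irrelevant. *)
Record symmetric_markov_semigroup (P : R -> (X -> R) -> (X -> R)) : Prop := {
  sg_L2 : forall (t : R) (f : X -> R), 0 <= t -> f \in Lfun mu 2%:E ->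
    P t f \in Lfun mu 2%:E ;
  sg_ae : forall (t : R) (f g : X -> R), 0 <= t ->
    f \in Lfun mu 2%:E -> g \in Lfun mu 2%:E ->
    f = g %[ae mu] -> P t f = P t g %[ae mu] ;
  sg_linear : forall (t a : R) (f g : X -> R), 0 <= t ->
    f \in Lfun mu 2%:E -> g \in Lfun mu 2%:E ->
    P t (fun x => a * f x + g x) = (fun x => a * P t f x + P t g x)
      %[ae mu] ;
  sg_zero : forall f : X -> R, f \in Lfun mu 2%:E -> P 0 f = f %[ae mu] ;
  sg_add : forall (s t : R) (f : X -> R), 0 <= s -> 0 <= t ->
    f \in Lfun mu 2%:E -> P (s + t) f = P s (P t f) %[ae mu] ;
  sg_positive : forall (t : R) (f : X -> R), 0 <= t ->
    f \in Lfun mu 2%:E -> {ae mu, forall x, 0 <= f x} ->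
    {ae mu, forall x, 0 <= P t f x} ;
  sg_one : forall t : R, 0 <= t -> P t (cst 1) = cst 1 %[ae mu] ;
  sg_symmetric : forall (t : R) (f g : X -> R), 0 <= t ->
    f \in Lfun mu 2%:E -> g \in Lfun mu 2%:E ->
    \int[mu]_x (f x * P t g x) = \int[mu]_x (P t f x * g x) ;
  sg_continuous : forall f : X -> R, f \in Lfun mu 2%:E ->
    L2_norm (fun x => P t f x - f x) @[t --> 0^'+] --> 0%E
}.

Variable P : R -> (X -> R) -> (X -> R).

Definition generator_graph (f g : X -> R) : Prop :=
  [/\ f \in Lfun mu 2%:E, g \in Lfun mu 2%:E &
    L2_norm (fun x => t^-1 * (P t f x - f x) - g x)
      @[t --> 0^'+] --> 0%E].

Definition generator_domain : set (X -> R) :=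
  [set f | exists g : X -> R, generator_graph f g].

(* A representative of L f, which is determined up to mu-a.e. equality. *)
Definition generator (f : X -> R) : X -> R :=
  xget (cst 0) [set g | generator_graph f g].

Definition Gamma (f g : X -> R) : X -> R := fun x =>
  2^-1 * (generator (fun y => f y * g y) x
          - f x * generator g x - g x * generator f x).

(* P is a mu-symmetric diffusion semigroup, whose carre du champ is defined on
   the algebra A of "smooth enough" functions, e.g. the smooth functions on R^n
   that are constant outside a compact set. *)
Record diffusion_semigroup (A : set (X -> R)) : Prop := {
  dsg_semigroup : symmetric_markov_semigroup P ;
  dsg_bounded : forall f : X -> R, A f -> bounded_fun f ;
  dsg_domain : A `<=` generator_domain ;
  dsg_cst : forall c : R, A (cst c) ;
  dsg_add : forall f g : X -> R, A f -> A g -> A (fun x => f x + g x) ;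
  dsg_mul : forall f g : X -> R, A f -> A g -> A (fun x => f x * g x) ;
  dsg_dense : forall (f : X -> R) (e : R), f \in Lfun mu 2%:E -> 0 < e ->
    exists2 g : X -> R, A g & (L2_norm (fun x => (f x - g x)%R) < e%:E)%E ;
  dsg_comp : forall (phi : R -> R) (f : X -> R), smooth phi -> A f ->
    A (phi \o f) ;
  dsg_chain : forall (phi : R -> R) (f : X -> R), smooth phi -> A f ->
    generator (phi \o f) =
    (fun x => derive1 phi (f x) * generator f x
              + derive1n 2 phi (f x) * Gamma f f x)
      %[ae mu]
}.

End semigroup.

Section inequalities.
Context (d : measure_display) (X : measurableType d) (R : realType).
Variables (mu : probability X R) (F : R -> R).

Definition centered (f : X -> R) : X -> R := fun x => f x - \int[mu]_y f y.

(* Where g x = 0 the integrand is 0, whatever the value of F at 0. *)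
Definition F_functional (g : X -> R) : R :=
  \int[mu]_x (g x ^+ 2 * F (g x ^+ 2 / \int[mu]_y (g y ^+ 2))).

Variables (P : R -> (X -> R) -> (X -> R)) (A : set (X -> R)).

Definition defective_F_Sobolev (C Ct : R) : Prop :=
  forall f : X -> R, A f ->
    F_functional f <=
      C * \int[mu]_x Gamma mu P f f x + Ct * \int[mu]_x (f x ^+ 2).

Definition tight_F_Sobolev (C : R) : Prop :=
  forall f : X -> R, A f ->
    F_functional f <= C * \int[mu]_x Gamma mu P f f x.

Definition Poincare (C : R) : Prop :=
  forall f : X -> R, A f ->
    \int[mu]_x (centered f x ^+ 2) <= C * \int[mu]_x Gamma mu P f f x.

End inequalities.

(* C is an admissible value of C_Rot(F): it serves all probability spaces. *)
Definition rothaus_constant (R : realType) (F : R -> R) (C : R) : Prop :=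
  forall (d : measure_display) (T : measurableType d) (nu : probability T R)
    (f : T -> R), measurable_fun [set: T] f -> bounded_fun f ->
    F_functional nu F f <=
      F_functional nu F (centered nu f)
      + C * \int[nu]_x (centered nu f x ^+ 2).

(* Main.v *)
Require Import Defs.
From HB Require Import structures.
From mathcomp Require Import all_boot all_order all_algebra.
From mathcomp Require Import all_classical all_reals all_analysis.
From mathcomp Require Import measurable_realfun.
From mathcomp Require Import ring lra.

Set Implicit Arguments.
Unset Strict Implicit.

Import Order.TTheory GRing.Theory Num.Theory.
Import numFieldNormedType.Exports.

Local Open Scope classical_set_scope.
Local Open Scope ring_scope.

(** Tightening a defective inequality with the help of a Poincare inequality
    rests on Rothaus' lemma: replacing f by its centering g = f - m, where
    m is the mean of f, costs at most a multiple of the variance of f.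
    Since Gamma is insensitive to additive constants, the defective inequality
    applied to g then bounds F_functional f by C_F times the energy of f plus
    (Ct_F + C_Rot) times the variance of f, and the Poincare inequality turns
    the variance into energy ([tight_of_rothaus]).

    Multiplying the Poincare inequality by Ct_F + C_Rot requires this number to
    be nonnegative.  The defective inequality for the constant function 1, whose
    energy vanishes, reads 0 <= Ct_F ([defective_constant_ge0]).  The Rothaus
    inequality for a nonconstant function with mean zero, which is its own
    centering, gives 0 <= C_Rot ([rothaus_constant_ge0]).

    The existence of a Rothaus constant ([exists_rothaus_constant]) is obtained
    by integrating a pointwise inequality.  With s the variance of f, the second
    moment of f is m ^+ 2 + s, and [rothaus_pointwise] says that
      (m + g) ^+ 2 * F ((m + g) ^+ 2 / (m ^+ 2 + s)) - g ^+ 2 * F (g ^+ 2 / s)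
    is at most 2 F'(1) m g + C (g ^+ 2 + s).  The linear term has integral 0 and
    the rest integrates to 2 C s.  Where g is small compared with m, the
    inequality is a second-order expansion, bounded above by the tangent of the
    concave function F at 1.  Where g dominates m, the two arguments of F are
    comparable, and F grows at most logarithmically because u F'(u) is bounded,
    so that the cross terms are of order g ^+ 2 as well. *)

(** * Concavity and growth of F *)

(** The chord slopes of F issued from u decrease along the segment from u to v,
    and their limit at u is the derivative in the direction v - u.  Working with
    this directional derivative treats v < u and u < v at once. *)
Lemma admissible_le_tangent (R : realType) (F : R -> R) (u v : R) :
  admissible F -> 0 < u -> 0 < v -> F v <= F u + derive1 F u * (v - u).
Proof.
move=> aF u0 v0.
have dF : differentiable F u by apply/derivable1_diffP; exact: adm_derivable.
rewrite -lerBlDl.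
have -> : derive1 F u * (v - u) = 'D_(v - u) F u.
  rewrite derive1E' // deriveE // mulrC.
  have : 'd F u ((v - u) *: (1 : R^o)) = (v - u) *: 'd F u 1 by rewrite linearZ.
  by rewrite /GRing.scale /= mulr1.
have /cvg_ex[l Fl] : derivable F u (v - u) by exact: diff_derivable.
rewrite /derive (cvg_lim _ Fl) //.
have {}Fl : h^-1 *: ((F \o shift u) (h *: (v - u)) - F u) @[h --> 0^'+] --> l.
  exact: cvg_dnbhs_at_right.
apply: (cvgr_to_ge Fl); near=> h.
have h0 : 0 < h by [].
have h1 : h <= 1 by near: h; exact: nbhs_right_le.
have pos (x : R) : 0 < x -> x \in `]0, +oo[%classic.
  by move=> x0; rewrite inE /= in_itv /= x0.
have Fconc : - F (h * v + (1 - h) * u) <= h * - F v + (1 - h) * - F u.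
  exact: (adm_concave aF (Itv01 (ltW h0) h1) (pos v v0) (pos u u0)).
rewrite /= -ler_pdivrMl ?invr_gt0 // invrK /GRing.scale /=.
rewrite (_ : h * (v - u) + u = h * v + (1 - h) * u); last by ring.
lra.
Unshelve. all: by end_near. Qed.

(** A consequence of F'(u) <= K / u, weaker than the bound K ln (v / u) on the
    increments of F, which suffices here and avoids logarithms. *)
Definition sublog_growth (R : realType) (F : R -> R) (K : R) : Prop :=
  forall u v : R, 0 < u -> u <= v -> F v <= F u + K * (v / u - 1).

Lemma admissible_growth (R : realType) (F : R -> R) :
  admissible F -> exists2 K : R, 0 <= K & sublog_growth F K.
Proof.
move=> aF; have [K FK] := adm_bound aF.
exists `|K| => // u v u0 uv.
have v0 : 0 < v by exact: lt_le_trans uv.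
apply: le_trans (admissible_le_tangent aF u0 v0) _; rewrite lerD2l.
rewrite (_ : v / u - 1 = u^-1 * (v - u)); last by field; rewrite gt_eqF.
rewrite mulrA ler_wpM2r ?subr_ge0 // ler_pdivlMr // mulrC.
exact: le_trans (FK u u0) (ler_norm _).
Qed.

Lemma admissible_homo (R : realType) (F : R -> R) (u v : R) :
  admissible F -> 0 < u -> u <= v -> F u <= F v.
Proof.
move=> aF u0 uv; apply: (adm_nondecreasing aF) => //; rewrite in_itv /= andbT //.
exact: lt_le_trans uv.
Qed.

Lemma admissible_ge0 (R : realType) (F : R -> R) (u : R) :
  admissible F -> 1 <= u -> 0 <= F u.
Proof. by move=> aF u1; rewrite -(adm_one aF) admissible_homo. Qed.

Lemma admissible_le0 (R : realType) (F : R -> R) (u : R) :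
  admissible F -> 0 < u -> u <= 1 -> F u <= 0.
Proof. by move=> aF u0 u1; rewrite -(adm_one aF) admissible_homo. Qed.

Lemma admissible_derive1_ge0 (R : realType) (F : R -> R) :
  admissible F -> 0 <= derive1 F 1.
Proof.
move=> aF; have := admissible_le_tangent aF ltr01 (ltr0n _ 2).
have := admissible_ge0 aF (ler1n _ 2); rewrite (adm_one aF).
lra.
Qed.

(** With w = g ^+ 2 / s the quantity is s * (w * F w), and comparing F w with
    F 1 = 0 shows that w * F w stays above -K near 0, even though F itself may
    tend to minus infinity there. *)
Lemma admissible_lower_bound (R : realType) (F : R -> R) (K : R) :
  admissible F -> 0 <= K -> sublog_growth F K ->
  forall g s : R, 0 < s -> - (K * s) <= g ^+ 2 * F (g ^+ 2 / s).
Proof.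
move=> aF K0 FK g s s0.
have [->|g0] := eqVneq g 0.
  by rewrite expr0n /= mul0r oppr_le0 mulr_ge0 // ltW.
have w0 : 0 < g ^+ 2 / s by rewrite divr_gt0 // exprn_even_gt0.
rewrite [X in X * F _](_ : _ = s * (g ^+ 2 / s)); last first.
  by field; rewrite gt_eqF.
move: (g ^+ 2 / s) w0 => w w0; rewrite mulrC -mulrN -mulrA ler_wpM2l ?(ltW s0) //.
have [w1|/ltW w1] := leP w 1; last first.
  rewrite (le_trans (y := 0)) ?oppr_le0 // mulr_ge0 ?(ltW w0) //.
  exact: admissible_ge0.
have : w * F 1 <= w * (F w + K * (1 / w - 1)) by rewrite ler_wpM2l ?(ltW w0) // FK.
rewrite (adm_one aF) mulr0.
rewrite (_ : w * (F w + K * (1 / w - 1)) = w * F w + K * (1 - w)); last first.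
  by field; rewrite gt_eqF.
have : 0 <= K * w by rewrite mulr_ge0 // ltW.
lra.
Qed.

(** Two growth steps, from 1 to x and from x to x ^+ 2, each cost at most K * x.
    Hence F grows no faster than a square root, which is what makes the cross
    terms m * g * F in Rothaus' lemma quadratic in g. *)
Lemma admissible_sqr_le (R : realType) (F : R -> R) (K : R) :
  admissible F -> 0 <= K -> sublog_growth F K ->
  forall x : R, 1 <= x -> F (x ^+ 2) <= 2 * K * x.
Proof.
move=> aF K0 FK x x1; have x0 : 0 < x by exact: lt_le_trans x1.
have := FK 1 x ltr01 x1; rewrite (adm_one aF) divr1 add0r => Fx.
have := FK x (x ^+ 2) x0; rewrite expr2 ler_peMl ?(ltW x0) // => /(_ isT).
rewrite mulfK ?gt_eqF //; lra.
Qed.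

(** * Rothaus' lemma *)

(** Both sides are homogeneous of degree 2 in (m, g, sqrt s), so the only regimes
    to separate are those where m or g dominates.  The term linear in g is
    unavoidable: it is the first-order part of the left-hand side for small g
    and s, and it disappears after integration because g will have mean 0. *)
Lemma rothaus_pointwise (R : realType) (F : R -> R) : admissible F ->
  exists C : R, forall m g s : R, 0 < s ->
    (m + g) ^+ 2 * F ((m + g) ^+ 2 / (m ^+ 2 + s)) - g ^+ 2 * F (g ^+ 2 / s)
      <= 2 * derive1 F 1 * m * g + C * (g ^+ 2 + s).
Proof.
move=> aF; have [K K0 FK] := admissible_growth aF.
set c := derive1 F 1; have c0 : 0 <= c by exact: admissible_derive1_ge0.
have sqn (x : R) : `|x| ^+ 2 = x ^+ 2 by rewrite real_normK ?num_real.
exists (10 * c + 15 * K) => m g s s0.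
have low := admissible_lower_bound aF K0 FK g s0.
have n0 : 0 < m ^+ 2 + s by rewrite ltr_wpDl // sqr_ge0.
have cgg : 0 <= c * g ^+ 2 by rewrite mulr_ge0 // sqr_ge0.
have Kgg : 0 <= K * g ^+ 2 by rewrite mulr_ge0 // sqr_ge0.
have cs : 0 <= c * s by rewrite mulr_ge0 // ltW.
have Ks : 0 <= K * s by rewrite mulr_ge0 // ltW.
have [gm|mg] := leP `|g| `|m|.
  (* The mean dominates: F lies below its tangent at 1, and the resulting
     polynomial is expanded to second order around g = 0. *)
  suff : (m + g) ^+ 2 * F ((m + g) ^+ 2 / (m ^+ 2 + s)) <=
      c * (2 * m * g + 10 * g ^+ 2 + 2 * s) by lra.
  have [mg0|mg0] := eqVneq (m + g) 0.
    have -> : m = - g by lra.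
    by rewrite addNr expr0n mul0r mulr_ge0 //; have := sqr_ge0 g; lra.
  have v0 : 0 < (m + g) ^+ 2 / (m ^+ 2 + s).
    by rewrite divr_gt0 // exprn_even_gt0.
  have := admissible_le_tangent aF ltr01 v0.
  rewrite (adm_one aF) add0r -/c => Fv.
  apply: (le_trans (ler_wpM2l (sqr_ge0 _) Fv)).
  rewrite mulrCA ler_wpM2l //.
  rewrite (_ : (m + g) ^+ 2 * ((m + g) ^+ 2 / (m ^+ 2 + s) - 1) =
    (m + g) ^+ 2 * (2 * m * g + g ^+ 2 - s) / (m ^+ 2 + s)); last first.
    by field; rewrite gt_eqF.
  rewrite ler_pdivrMr //.
  have g2 : g ^+ 2 <= m ^+ 2 by rewrite -(sqn g) -(sqn m) ler_sqr.
  have mg2 : m * g <= m ^+ 2.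
    rewrite (le_trans (ler_norm _)) // normrM -(sqn m) expr2.
    by rewrite ler_wpM2l.
  have h1 : 0 <= g ^+ 2 * (m ^+ 2 - m * g) by rewrite mulr_ge0 ?sqr_ge0 ?subr_ge0.
  have h2 : 0 <= g ^+ 2 * (m ^+ 2 - g ^+ 2) by rewrite mulr_ge0 ?sqr_ge0 ?subr_ge0.
  have h3 : 0 <= s * (2 * (m + g) ^+ 2 + m ^+ 2 + 9 * g ^+ 2 + 2 * s).
    have := sqr_ge0 m; have := sqr_ge0 g; have := sqr_ge0 (m + g).
    by move=> *; rewrite mulr_ge0 ?(ltW s0) //; lra.
  nra.
(* From here on the fluctuation g dominates, and the linear term is absorbed in
   g ^+ 2. *)
have cmg : - (2 * c * m * g) <= 2 * (c * g ^+ 2).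
  have mg2 : - (m * g) <= g ^+ 2.
    rewrite -mulNr; apply: (le_trans (ler_norm _)); rewrite normrM normrN.
    by rewrite -(sqn g) expr2 ler_wpM2r // ltW.
  by have := ler_wpM2l c0 mg2; lra.
have g0 : 0 < `|g| by exact: le_lt_trans mg.
have gg0 : 0 < g ^+ 2 by rewrite -sqn exprn_gt0.
set v := (m + g) ^+ 2 / (m ^+ 2 + s).
have [v1|/ltW v1] := leP v 1.
  suff : (m + g) ^+ 2 * F v <= 0 by lra.
  have [->|mg0] := eqVneq (m + g) 0; first by rewrite expr0n mul0r.
  rewrite mulr_ge0_le0 ?sqr_ge0 // admissible_le0 //.
  by rewrite divr_gt0 // exprn_even_gt0.
have v0 : 0 < v by exact: lt_le_trans v1.
have Fv0 : 0 <= F v by exact: admissible_ge0.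
have mgg : (m + g) ^+ 2 <= 4 * g ^+ 2.
  rewrite -(sqn g) -(sqn (m + g)).
  rewrite (_ : 4 * `|g| ^+ 2 = (2 * `|g|) ^+ 2); last by ring.
  rewrite ler_sqr ?nnegrE ?mulr_ge0 //.
  have := ler_normD m g; lra.
have mono (x y : R) : 0 < x -> x <= y -> F x <= F y by exact: admissible_homo.
set w := g ^+ 2 / s; have w0 : 0 < w by rewrite divr_gt0.
(* The arguments of F differ at most by the factor 4, so that the main parts
   g ^+ 2 * F v and g ^+ 2 * F w differ by at most 3 * K * g ^+ 2. *)
have Fvw : F v <= F w + 3 * K.
  have vw : v <= 4 * w.
    rewrite /v /w mulrA ler_pM // ?sqr_ge0 // ?invr_ge0 ?(ltW n0) //.
    by rewrite lef_pV2 ?posrE // lerDr sqr_ge0.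
  apply: (le_trans (mono _ _ v0 vw)).
  have := FK w (4 * w) w0; rewrite mulfK ?gt_eqF //.
  have w4 : w <= 4 * w by lra.
  by move=> /(_ w4); lra.
(* Here v is at most (2 g / m) ^+ 2, where F is at most 4 * K * `|g| / `|m|. *)
have mFv : `|m| * F v <= 4 * K * `|g|.
  have [->|m0] := eqVneq m 0; first by rewrite normr0 mul0r !mulr_ge0.
  have m0' : 0 < `|m| by rewrite normr_gt0.
  have vx : v <= (2 * `|g| / `|m|) ^+ 2.
    rewrite expr_div_n exprMn !sqn /v ler_pM ?sqr_ge0 ?invr_ge0 ?(ltW n0) //.
      by rewrite -natrX.
    by rewrite lef_pV2 ?posrE ?exprn_even_gt0 // lerDl ltW.
  have x1 : 1 <= 2 * `|g| / `|m| by rewrite ler_pdivlMr //; lra.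
  have := le_trans (mono _ _ v0 vx) (admissible_sqr_le aF K0 FK x1).
  move=> /(ler_wpM2l (ltW m0')) /le_trans; apply.
  rewrite le_eqVlt; apply/orP; left; apply/eqP; field.
  by rewrite gt_eqF.
have t1 : g ^+ 2 * F v <= g ^+ 2 * (F w + 3 * K) by rewrite ler_wpM2l // ltW.
have t2 : (2 * m * g + m ^+ 2) * F v <= 12 * (K * g ^+ 2).
  apply: (@le_trans _ _ (3 * `|g| * (`|m| * F v))).
    rewrite mulrA ler_wpM2r //.
    have a1 : m * g <= `|g| * `|m| by rewrite mulrC -normrM ler_norm.
    have a2 : m ^+ 2 <= `|g| * `|m|.
      by rewrite -(sqn m) expr2 ler_wpM2r // ltW.
    lra.
  have := ler_wpM2l (ltW g0) mFv; rewrite -(sqn g); lra.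
lra.
Qed.

Lemma bounded_fun_le (R : realType) (T : Type) (f : T -> R) :
  bounded_fun f -> exists2 M : R, 0 <= M & forall x, `|f x| <= M.
Proof.
move=> [M [_ fM]]; exists (`|M| + 1); first by rewrite addr_ge0.
by move=> x; apply: fM => //; rewrite ltr_pwDr // ler_norm.
Qed.

Lemma le_bounded_integrable d (T : measurableType d) (R : realType)
    (nu : probability T R) (f : T -> R) (M : R) :
  measurable_fun [set: T] f -> (forall x, `|f x| <= M) ->
  nu.-integrable [set: T] (EFin \o f).
Proof.
move=> mf fM; apply: measurable_bounded_integrable => //.
  exact: le_lt_trans (probability_le1 nu measurableT) (ltry 1).
exists M; split; first exact: num_real.
by move=> y My x _; exact: le_trans (fM x) (ltW My).
Qed.

Lemma ae_eq_Rintegral d (T : measurableType d) (R : realType)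
    (nu : probability T R) (f g : T -> R) :
  measurable_fun [set: T] f -> measurable_fun [set: T] g ->
  f = g %[ae nu] -> \int[nu]_x f x = \int[nu]_x g x.
Proof.
move=> mf mg fg; rewrite /Rintegral; congr fine; apply: ae_eq_integral => //.
- exact/measurable_EFinP.
- exact/measurable_EFinP.
- by apply: filterS fg => x /= /(_ I) ->.
Qed.

(** F is only constrained on the positive half-line, and is arbitrary elsewhere;
    the factor f x ^+ 2 hides the value F 0.  For s = 0 the quotient is 0
    everywhere, so the integrand is a multiple of f x ^+ 2. *)
Lemma measurable_F_integrand d (T : measurableType d) (R : realType)
    (F : R -> R) (f : T -> R) (s : R) :
  admissible F -> 0 <= s -> measurable_fun [set: T] f ->
  measurable_fun [set: T] (fun x => f x ^+ 2 * F (f x ^+ 2 / s)).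
Proof.
move=> aF s0 mf.
have mf2 : measurable_fun [set: T] (fun x => f x ^+ 2) by exact: measurable_funX.
move: s0; rewrite le_eqVlt => /predU1P[<-|s0].
  by under eq_fun do rewrite invr0 mulr0; exact: measurable_funM.
have mF : measurable_fun [set: R] (F \_ `]0, +oo[).
  apply/(measurable_restrictT _ (measurable_itv _)).
  apply: open_continuous_measurable_fun; first exact: interval_open.
  move=> u; rewrite inE /= in_itv /= andbT => u0.
  by apply: differentiable_continuous; apply/derivable1_diffP; exact: adm_derivable.
have -> : (fun x => f x ^+ 2 * F (f x ^+ 2 / s)) =
    (fun x => f x ^+ 2 * (F \_ `]0, +oo[) (f x ^+ 2 / s)).
  apply/funext => x; have [->|fx0] := eqVneq (f x) 0.
    by rewrite expr0n /= !mul0r.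
  rewrite patchE mem_set //= in_itv /= andbT divr_gt0 //.
  by rewrite exprn_even_gt0.
apply: measurable_funM => //; apply: (measurableT_comp mF).
exact: measurable_funM.
Qed.

(** Although F may be unbounded near 0, the integrand is bounded: from below by
    [admissible_lower_bound], from above because f is bounded and F is
    nondecreasing. *)
Lemma integrable_F_integrand d (T : measurableType d) (R : realType)
    (nu : probability T R) (F : R -> R) (f : T -> R) (s : R) :
  admissible F -> 0 <= s -> measurable_fun [set: T] f -> bounded_fun f ->
  nu.-integrable [set: T] (EFin \o (fun x => f x ^+ 2 * F (f x ^+ 2 / s))).
Proof.
move=> aF s0 mf /bounded_fun_le[M M0 fM].
have mh := measurable_F_integrand aF s0 mf.
have f2M x : f x ^+ 2 <= M ^+ 2.
  by rewrite -[f x ^+ 2]real_normK ?num_real // ler_sqr.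
move: s0; rewrite le_eqVlt => /predU1P[s0|s0].
  apply: (@le_bounded_integrable _ _ _ _ _ (M ^+ 2 * `|F 0|)) => // x.
  by rewrite -s0 invr0 mulr0 normrM normrX ler_wpM2r // ler_sqr.
have [K K0 FK] := admissible_growth aF.
apply: (@le_bounded_integrable _ _ _ _ _ (K * s + M ^+ 2 * (K * (M ^+ 2 / s)))) => // x.
have Ks : 0 <= K * s by rewrite mulr_ge0 // ltW.
have Ms : 0 <= M ^+ 2 * (K * (M ^+ 2 / s)).
  by rewrite mulr_ge0 ?sqr_ge0 // mulr_ge0 // divr_ge0 ?sqr_ge0 // ltW.
rewrite ler_norml; apply/andP; split.
  have := admissible_lower_bound aF K0 FK (f x) s0; lra.
have [->|fx0] := eqVneq (f x) 0; first by rewrite expr0n mul0r addr_ge0.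
have w0 : 0 < f x ^+ 2 / s by rewrite divr_gt0 // exprn_even_gt0.
apply: (@le_trans _ _ (M ^+ 2 * (K * (M ^+ 2 / s)))); last by rewrite lerDr.
have [w1|/ltW w1] := leP (f x ^+ 2 / s) 1.
  rewrite (le_trans _ Ms) // mulr_ge0_le0 ?sqr_ge0 //.
  exact: admissible_le0.
apply: ler_pM => //; first exact: sqr_ge0.
  exact: admissible_ge0.
have := FK 1 _ ltr01 w1; rewrite (adm_one aF) add0r divr1 => /le_trans; apply.
rewrite ler_wpM2l // lerBlDr (le_trans (y := M ^+ 2 / s)) ?lerDl //.
by rewrite ler_wpM2r // invr_ge0 ltW.
Qed.

Lemma probability_Rintegral_cst d (T : measurableType d) (R : realType)
    (nu : probability T R) (c : R) : \int[nu]_x c = c.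
Proof. by rewrite Rintegral_cst //= probability_setT mulr1. Qed.

Section centering.
Context d (T : measurableType d) (R : realType) (nu : probability T R).
Variable f : T -> R.
Hypotheses (mf : measurable_fun [set: T] f) (bf : bounded_fun f).

Lemma bounded_integrable : nu.-integrable [set: T] (EFin \o f).
Proof.
have [M _ fM] := bounded_fun_le bf.
exact: le_bounded_integrable fM.
Qed.

Lemma bounded_sqr_integrable :
  nu.-integrable [set: T] (EFin \o (fun x => f x ^+ 2)).
Proof.
have [M M0 fM] := bounded_fun_le bf.
apply: (@le_bounded_integrable _ _ _ _ _ (M ^+ 2)).
  exact: measurable_funX.
by move=> x; rewrite normrX ler_sqr.
Qed.

Lemma measurable_centered : measurable_fun [set: T] (centered nu f).
Proof. exact: measurable_funB. Qed.

Lemma bounded_centered : bounded_fun (centered nu f).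
Proof.
have [M _ fM] := bounded_fun_le bf.
exists (M + `|\int[nu]_x f x|); split; first exact: num_real.
move=> y My x _; apply: le_trans (ltW My).
by apply: le_trans (ler_normB _ _) _; rewrite lerD2r.
Qed.

Lemma Rintegral_centered : \int[nu]_x centered nu f x = 0.
Proof.
rewrite RintegralB //; last 2 first.
- exact: bounded_integrable.
- exact: finite_measure_integrable_cst.
by rewrite probability_Rintegral_cst subrr.
Qed.
End centering.

Lemma integrable_mulrl d (T : measurableType d) (R : realType)
    (nu : probability T R) (c : R) (f : T -> R) :
  nu.-integrable [set: T] (EFin \o f) ->
  nu.-integrable [set: T] (EFin \o (fun x => c * f x)).
Proof. by move=> /(integrableZl measurableT c). Qed.

Lemma integrable_addr d (T : measurableType d) (R : realType)
    (nu : probability T R) (f g : T -> R) :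
  nu.-integrable [set: T] (EFin \o f) -> nu.-integrable [set: T] (EFin \o g) ->
  nu.-integrable [set: T] (EFin \o (fun x => f x + g x)).
Proof. by move=> fi gi; have := integrableD measurableT fi gi. Qed.

Lemma integrable_subr d (T : measurableType d) (R : realType)
    (nu : probability T R) (f g : T -> R) :
  nu.-integrable [set: T] (EFin \o f) -> nu.-integrable [set: T] (EFin \o g) ->
  nu.-integrable [set: T] (EFin \o (fun x => f x - g x)).
Proof. by move=> fi gi; have := integrableB measurableT fi gi. Qed.

Lemma Rintegral_sqr_centered d (T : measurableType d) (R : realType)
    (nu : probability T R) (f : T -> R) :
  measurable_fun [set: T] f -> bounded_fun f ->
  \int[nu]_x (f x ^+ 2) =
    (\int[nu]_x f x) ^+ 2 + \int[nu]_x (centered nu f x ^+ 2).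
Proof.
move=> mf bf; set m := \int[nu]_x f x.
have mg := measurable_centered nu mf.
have bg := bounded_centered nu bf.
have ig := bounded_integrable nu mg bg.
have ig2 := bounded_sqr_integrable nu mg bg.
have -> : (fun x => f x ^+ 2) =
    (fun x => (m ^+ 2 + 2 * m * centered nu f x) + centered nu f x ^+ 2).
  by apply/funext => x; rewrite /centered -/m; ring.
have im : nu.-integrable [set: T] (EFin \o cst (m ^+ 2)).
  exact: finite_measure_integrable_cst.
have i2m : nu.-integrable [set: T] (EFin \o (fun x => 2 * m * centered nu f x)).
  exact: integrable_mulrl.
rewrite RintegralD //; last exact: integrable_addr.
rewrite RintegralD // probability_Rintegral_cst RintegralZl //.
by rewrite Rintegral_centered // mulr0 addr0.
Qed.

Lemma Rintegral_sqr_eq0 d (T : measurableType d) (R : realType)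
    (nu : probability T R) (g : T -> R) :
  measurable_fun [set: T] g -> bounded_fun g ->
  \int[nu]_x (g x ^+ 2) = 0 -> g = cst 0 %[ae nu].
Proof.
move=> mg bg; rewrite /Rintegral => /eqP g0.
have ig2 := bounded_sqr_integrable nu mg bg.
have mg2 : measurable_fun [set: T] (EFin \o (fun x => g x ^+ 2)).
  by apply/measurable_EFinP; exact: measurable_funX.
have : (\int[nu]_x `|(EFin \o (fun y => (g y ^+ 2)%R)) x| = 0)%E.
  transitivity (\int[nu]_x (g x ^+ 2)%:E)%E.
    by apply: eq_integral => x _; rewrite /= ger0_norm ?sqr_ge0.
  by rewrite -[LHS]fineK ?(eqP g0) //; exact: integrable_fin_num.
move/(ae_eq_integral_abs _ measurableT mg2); apply: filterS => x /= /(_ I).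
by move=> [] /eqP; rewrite sqrf_eq0 => /eqP.
Qed.

(** For positive variance s this is the integral of [rothaus_pointwise].  If s
    vanishes, f is almost everywhere equal to its mean and both functionals are
    0 since F 1 = 0. *)
Lemma exists_rothaus_constant (R : realType) (F : R -> R) :
  admissible F -> exists C : R, rothaus_constant F C.
Proof.
move=> aF; have [C0 point] := rothaus_pointwise aF.
exists (2 * C0) => d T nu f mf bf.
have mg := measurable_centered nu mf.
have bg := bounded_centered nu bf.
have ig := bounded_integrable nu mg bg.
have ig2 := bounded_sqr_integrable nu mg bg.
have g_mean := Rintegral_centered nu mf bf.
rewrite /F_functional Rintegral_sqr_centered //.
set m := \int[nu]_x f x; set g := centered nu f; set s := \int[nu]_x (g x ^+ 2).
have fE x : f x = m + g x by rewrite /g /centered -/m; ring.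
have s0 : 0 <= s by apply: Rintegral_ge0 => x _; exact: sqr_ge0.
have n0 : 0 <= m ^+ 2 + s by rewrite addr_ge0 // sqr_ge0.
have mLf := measurable_F_integrand aF n0 mf.
have mLg := measurable_F_integrand aF s0 mg.
have iLf := integrable_F_integrand nu aF n0 mf bf.
have iLg := integrable_F_integrand nu aF s0 mg bg.
move: s0; rewrite le_eqVlt => /predU1P[s0|s0].
  have g0 : g = cst 0 %[ae nu] by exact: Rintegral_sqr_eq0.
  move: mLf mLg; rewrite -s0 mulr0 !addr0 => mLf mLg.
  rewrite (@ae_eq_Rintegral _ _ _ nu _ (cst 0)) //; last first.
    apply: filterS g0 => x /(_ I) /= g0 _; rewrite fE g0 addr0.
    have [->|m0] := eqVneq m 0; first by rewrite expr0n mul0r.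
    by rewrite divff ?sqrf_eq0 // (adm_one aF) mulr0.
  rewrite (@ae_eq_Rintegral _ _ _ nu _ (cst 0)) //.
  by apply: filterS g0 => x /(_ I) /= -> _; rewrite expr0n mul0r.
rewrite -lerBlDl -RintegralB //.
have iR1 : nu.-integrable [set: T] (EFin \o (fun x => 2 * derive1 F 1 * m * g x)).
  exact: integrable_mulrl.
have is1 : nu.-integrable [set: T] (EFin \o cst s).
  exact: finite_measure_integrable_cst.
have iR2 : nu.-integrable [set: T] (EFin \o (fun x => g x ^+ 2 + s)).
  exact: integrable_addr.
have iR3 : nu.-integrable [set: T] (EFin \o (fun x => C0 * (g x ^+ 2 + s))).
  exact: integrable_mulrl.
apply: (@le_trans _ _
  (\int[nu]_x (2 * derive1 F 1 * m * g x + C0 * (g x ^+ 2 + s)))).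
  apply: le_Rintegral => //.
  - exact: integrable_subr.
  - exact: integrable_addr.
  - by move=> x _; rewrite {1 2}fE; exact: point.
rewrite RintegralD // (RintegralZl _ measurableT ig) g_mean mulr0 add0r.
rewrite RintegralZl // RintegralD // probability_Rintegral_cst -/s; lra.
Qed.

(** A function with mean zero is its own centering, so the inequality reduces to
    0 <= C times its variance.  The sign of a fair coin is such a function with
    positive variance; since C serves all probability spaces, it may be used. *)
Lemma rothaus_constant_ge0 (R : realType) (F : R -> R) (C : R) :
  rothaus_constant F C -> 0 <= C.
Proof.
move=> rothC.
pose nu : probability bool R := bernoulli_prob (2^-1 : R).
(* Centering h gives the values 1 and -1. *)
pose h (b : bool) : R := if b then 2 else 0.
have bool_bounded (k : bool -> R) : bounded_fun k.
  exists (`|k true| + `|k false|); split; first exact: num_real.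
  move=> y ky b _; apply: le_trans (ltW ky).
  by case: b; rewrite ?lerDl ?lerDr.
have half : 0 <= (2^-1 : R) <= 1 by rewrite invr_ge0 invf_le1 //=; lra.
have int_nu (k : bool -> R) : (forall b, 0 <= k b) ->
    \int[nu]_b k b = 2^-1 * k true + 2^-1 * k false.
  move=> k0; rewrite /Rintegral integral_bernoulli_prob //.
  by rewrite /= /unstable.onem; congr (_ + _ * _); lra.
have mean_h : \int[nu]_b h b = 1.
  by rewrite int_nu /h; [lra|case; lra].
pose g := centered nu h.
have mean_g : \int[nu]_b g b = 0 by exact: Rintegral_centered.
have gg : centered nu g = g by apply/funext => b; rewrite {1}/centered mean_g subr0.
have mg : measurable_fun [set: bool] g by [].
have := rothC _ _ nu g mg (bool_bounded g).
rewrite gg -lerBlDl subrr int_nu; last by move=> b; exact: sqr_ge0.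
by rewrite /g /centered mean_h /h; lra.
Qed.

(** * Smoothness of translations and of their squares *)

Lemma smooth_derive1 (R : realType) (phi : R -> R) :
  (forall x, derivable phi x 1) -> smooth (derive1 phi) -> smooth phi.
Proof. by move=> d1 sm [|n] x; [exact: d1|rewrite derive1Sn; exact: sm]. Qed.

Lemma derive1_cst_fun (R : realType) (c : R) :
  derive1 (cst c : R -> R) = cst 0.
Proof. by apply/funext => x; rewrite derive1_cst. Qed.

Lemma smooth_cst (R : realType) (c : R) : smooth (cst c : R -> R).
Proof.
move=> n x; suff [k ->] : exists k : R, derive1n n (cst c : R -> R) = cst k.
  exact: derivable_cst.
elim: n => [|n [k IH]]; first by exists c.
by exists 0; rewrite derive1nS IH derive1_cst_fun.
Qed.

Lemma is_derive_subr (R : realType) (c x : R) :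
  is_derive x (1 : R) (fun y : R => y - c) 1.
Proof. exact: is_derive_shift. Qed.

Lemma derive1_shift (R : realType) (c : R) :
  derive1 (fun x : R => x - c) = cst 1.
Proof.
apply/funext => x; rewrite derive1E.
by have H := is_derive_subr c x; rewrite derive_val.
Qed.

Lemma smooth_shift (R : realType) (c : R) : smooth (fun x : R => x - c).
Proof.
apply: smooth_derive1; last by rewrite derive1_shift; exact: smooth_cst.
by move=> x; have [] := is_derive_subr c x.
Qed.

Lemma is_derive_subr_sqr (R : realType) (c x : R) :
  is_derive x (1 : R) (fun y : R => (y - c) ^+ 2) (2 * (x - c)).
Proof.
have := is_deriveX 2 (is_derive_subr c x).
by rewrite /GRing.scale /= mulr1 expr1.
Qed.

Lemma derive1_shift_sqr (R : realType) (c : R) :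
  derive1 (fun x : R => (x - c) ^+ 2) = (fun x => 2 * (x - c)).
Proof.
apply/funext => x; rewrite derive1E.
by have H := is_derive_subr_sqr c x; rewrite derive_val.
Qed.

Lemma is_derive_scale_subr (R : realType) (c x : R) :
  is_derive x (1 : R) (fun y : R => 2 * (y - c)) 2.
Proof.
have := is_deriveZ (2 : R) (is_derive_subr c x).
by rewrite /GRing.scale /= mulr1.
Qed.

Lemma derive1_scale_shift (R : realType) (c : R) :
  derive1 (fun x : R => 2 * (x - c)) = cst 2.
Proof.
apply/funext => x; rewrite derive1E.
by have H := is_derive_scale_subr c x; rewrite derive_val.
Qed.

Lemma smooth_shift_sqr (R : realType) (c : R) :
  smooth (fun x : R => (x - c) ^+ 2).
Proof.
apply: smooth_derive1.
  by move=> x; have [] := is_derive_subr_sqr c x.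
rewrite derive1_shift_sqr; apply: smooth_derive1.
  by move=> x; have [] := is_derive_scale_subr c x.
by rewrite derive1_scale_shift; exact: smooth_cst.
Qed.

(** * The carre du champ of centered functions *)

Section diffusion.
Context d (X : measurableType d) (R : realType) (mu : probability X R).
Variables (P : R -> (X -> R) -> (X -> R)) (A : set (X -> R)).
Hypothesis dP : diffusion_semigroup mu P A.

Lemma measurable_smooth_enough (f : X -> R) :
  A f -> measurable_fun [set: X] f.
Proof.
move=> /(dsg_domain dP)[g [fL _ _]].
exact: set_mem (sub_Lfun_mfun fL).
Qed.

Lemma measurable_generator (f : X -> R) :
  A f -> measurable_fun [set: X] (generator mu P f).
Proof.
move=> /(dsg_domain dP) fD; have [_ gL _] := xgetPex (cst 0) fD.
exact: set_mem (sub_Lfun_mfun gL).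
Qed.

Lemma measurable_Gamma (f g : X -> R) :
  A f -> A g -> measurable_fun [set: X] (Gamma mu P f g).
Proof.
move=> Af Ag.
have mf := measurable_smooth_enough Af.
have mg := measurable_smooth_enough Ag.
have mLf := measurable_generator Af.
have mLg := measurable_generator Ag.
have mLfg := measurable_generator (dsg_mul dP Af Ag).
apply: measurable_funM => //.
by apply: measurable_funB; [apply: measurable_funB => //|]; exact: measurable_funM.
Qed.

(** The chain rule for z - c gives L (f - c) = L f, and for (z - c) ^+ 2 it gives
    L ((f - c) ^+ 2) = 2 (f - c) L f + 2 Gamma f f; the terms containing L f
    cancel in the definition of Gamma. *)
Lemma Gamma_shift (f : X -> R) (c : R) : A f ->
  Gamma mu P (fun x => f x - c) (fun x => f x - c) = Gamma mu P f f %[ae mu].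
Proof.
move=> Af.
have L1 := dsg_chain dP (@smooth_shift R c) Af.
have L2 := dsg_chain dP (@smooth_shift_sqr R c) Af.
rewrite !derive1nS derive1n0 derive1_shift derive1_cst_fun in L1.
rewrite !derive1nS derive1n0 derive1_shift_sqr derive1_scale_shift in L2.
apply: filterS2 L1 L2 => x /(_ I) L1 /(_ I) L2 _.
rewrite {1}/Gamma.
rewrite (_ : (fun y => (f y - c) * (f y - c)) =
  (fun z : R => (z - c) ^+ 2) \o f); last by apply/funext => y /=; rewrite expr2.
rewrite L2 (_ : (fun y => f y - c) = (fun z : R => z - c) \o f) // L1 /=.
by field.
Qed.

(** The chain rule for a constant phi makes the generator vanish on constants. *)
Lemma Gamma_cst (c : R) :
  Gamma mu P (cst c) (cst c) = cst 0 %[ae mu].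
Proof.
have L1 := dsg_chain dP (@smooth_cst R c) (dsg_cst dP 0).
have L2 := dsg_chain dP (@smooth_cst R (c * c)) (dsg_cst dP 0).
rewrite !derive1nS derive1n0 !derive1_cst_fun in L1 L2.
apply: filterS2 L1 L2 => x /(_ I) L1 /(_ I) L2 _.
rewrite /Gamma -[fun y => _]/(cst (c * c) \o (cst 0 : X -> R)) L2.
rewrite -[in X in X - _]/(cst c \o (cst 0 : X -> R)) L1 /=.
by rewrite !mul0r !addr0 !mulr0 !subr0 mulr0.
Qed.

Lemma centered_smooth_enough (f : X -> R) : A f -> A (centered mu f).
Proof. exact: (dsg_comp dP (@smooth_shift R (\int[mu]_x f x))). Qed.

Lemma Rintegral_Gamma_centered (f : X -> R) : A f ->
  \int[mu]_x Gamma mu P (centered mu f) (centered mu f) x =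
  \int[mu]_x Gamma mu P f f x.
Proof.
move=> Af; have Ag := centered_smooth_enough Af.
exact: (ae_eq_Rintegral (measurable_Gamma Ag Ag) (measurable_Gamma Af Af)
  (Gamma_shift _ Af)).
Qed.

(** Test with f = 1: its energy is 0 and its F-functional is F 1 = 0. *)
Lemma defective_constant_ge0 (F : R -> R) (C Ct : R) :
  F 1 = 0 -> defective_F_Sobolev mu F P A C Ct -> 0 <= Ct.
Proof.
move=> F1 /(_ _ (dsg_cst dP 1)).
rewrite (ae_eq_Rintegral _ _ (Gamma_cst 1)) //; last first.
  exact: measurable_Gamma (dsg_cst dP 1) (dsg_cst dP 1).
rewrite /F_functional /= expr1n.
rewrite !probability_Rintegral_cst divr1 F1 mulr0.
by rewrite mulr0 add0r mulr1.
Qed.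

Lemma tight_of_rothaus (F : R -> R) (C_F Ct_F C_P C_Rot : R) : F 1 = 0 ->
  defective_F_Sobolev mu F P A C_F Ct_F -> Poincare mu P A C_P ->
  rothaus_constant F C_Rot ->
  tight_F_Sobolev mu F P A (C_F + C_P * (Ct_F + C_Rot)).
Proof.
move=> F1 defS poin roth f Af.
have Ag := centered_smooth_enough Af.
have C0 : 0 <= Ct_F + C_Rot.
  exact: addr_ge0 (defective_constant_ge0 F1 defS) (rothaus_constant_ge0 roth).
have Hroth := roth _ _ mu f (measurable_smooth_enough Af) (dsg_bounded dP Af).
have Hdef := defS _ Ag; rewrite Rintegral_Gamma_centered // in Hdef.
have Hpoin := ler_wpM2l C0 (poin f Af).
apply: le_trans Hroth _.
apply: le_trans (lerD Hdef (lexx _)) _.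
by rewrite -addrA -mulrDl [leRHS]mulrDl lerD2l [C_P * _]mulrC -mulrA.
Qed.
End diffusion.

Theorem theorem8 (R : realType) (d : measure_display) (X : measurableType d)
    (mu : probability X R)
    (P : R -> (X -> R) -> (X -> R)) (A : set (X -> R))
    (F : R -> R) (C_F Ct_F C_P : R) :
  diffusion_semigroup mu P A ->
  admissible F ->
  defective_F_Sobolev mu F P A C_F Ct_F ->
  Poincare mu P A C_P ->
  (exists C : R, tight_F_Sobolev mu F P A C) /\
  (forall C_Rot : R, rothaus_constant F C_Rot ->
     tight_F_Sobolev mu F P A (C_F + C_P * (Ct_F + C_Rot))).
Proof.
move=> dP aF defS poin.
have tight C_Rot : rothaus_constant F C_Rot ->
    tight_F_Sobolev mu F P A (C_F + C_P * (Ct_F + C_Rot)).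
  by apply: tight_of_rothaus => //; exact: adm_one.
split => //; have [C_Rot roth] := exists_rothaus_constant aF.
by exists (C_F + C_P * (Ct_F + C_Rot)); exact: tight.
Qed.
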